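(* For $n\ge 0$ let $q(0,0,n)$ be the number of walks with $n$ steps, each in $\{(1,0),(-1,0),(0,1),(0,-1)\}$, that start at $(0,0)$, end at $(0,0)$, and stay in the quarter plane $\mathbb{Z}_+^2=\{0,1,2,\dots\}^2$. Then, as $n\to\infty$, $$q(0,0,2n)\sim\frac{4}{\pi}\,\frac{16^{n}}{n^{3}} .$$
   Context: Here $f(n)\sim g(n)$ means $f(n)/g(n)\to 1$ as $n\to\infty$. *)

(* Defs.v *)
From HB Require Import structures.
From mathcomp Require Import all_boot all_order all_algebra.
From mathcomp Require Import all_classical all_reals all_analysis.

Set Implicit Arguments.
Unset Strict Implicit.
Unset Printing Implicit Defensive.

Import Order.TTheory GRing.Theory Num.Theory.
Import numFieldNormedType.Exports.

Local Open Scope classical_set_scope.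
Local Open Scope ring_scope.

Definition steps : seq (int * int) :=
  [:: (1, 0); (-1, 0); (0, 1); (0, -1)].

Definition step : finType := seq_sub steps.

Definition position (n : nat) (w : n.-tuple step) (k : nat) : int * int :=
  \sum_(s <- take k w) ssval s.

Definition in_quadrant (p : int * int) : bool := (0 <= p.1) && (0 <= p.2).

(* A walk starting at the origin is encoded by its sequence of steps; it is
   required to stay in the quadrant at all times 0, ..., n. *)
Definition quadrant_walks (i j n : nat) : {set n.-tuple step} :=
  [set w : n.-tuple step |
    [forall k : 'I_n.+1, in_quadrant (position w k)]
    && (position w n == (i%:Z, j%:Z))].

Definition q (i j n : nat) : nat := #|quadrant_walks i j n|.

Definition asymp_equiv (R : realType) (f g : nat -> R) : Prop :=
  f n / g n @[n --> \oo] --> (1 : R).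

(* Main.v *)
(* In the coordinates (x + y, x - y) a walk in the plane is a pair of
   independent walks on the line, so the reflection principle in the lines
   x = -1 and y = -1 gives, with c = 'C(2 n, n),
     q(0, 0, 2 n) = c^2 - 2 'C(2 n, n + 1)^2 + c 'C(2 n, n + 2)
                  = c^2 (4 n + 2) / ((n + 1)^2 (n + 2)).
   The Wallis integrals W_n of cos^n over [0, pi / 2] satisfy
   W_(2 n) = c / 4^n * pi / 2, (n + 1) W_n W_(n + 1) = pi / 2 and
   W_(n + 1) <= W_n, whence 2 n / (2 n + 1) <= pi n c^2 / 16^n <= 1, and the
   ratio of the theorem lies between 1 - 4 / (n + 1) and 1. *)

Require Import Defs.
From HB Require Import structures.
From mathcomp Require Import all_boot all_order all_algebra.
From mathcomp Require Import all_classical all_reals all_analysis.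
From mathcomp Require Import zify ring lra.

Set Implicit Arguments.
Unset Strict Implicit.
Unset Printing Implicit Defensive.

Import Order.TTheory GRing.Theory Num.Theory.
Import numFieldNormedType.Exports.

Local Open Scope classical_set_scope.
Local Open Scope ring_scope.

(** * Counting quadrant walks by their first step *)

Lemma card_tuple_cons (T : finType) (n : nat) (A : {set n.+1.-tuple T}) :
  #|A| = (\sum_(s : T) #|[set w : n.-tuple T | [tuple of s :: w] \in A]%SET|)%N.
Proof.
under eq_bigr do rewrite cardsE -sum1_card.
rewrite pair_big_dep /= -sum1_card.
rewrite (reindex (fun sw : T * n.-tuple T => [tuple of sw.1 :: sw.2])) //=.
exists (fun w => (thead w, [tuple of behead w])) => [[s w] _|w _] /=.
  by congr pair; apply: val_inj.
by rewrite [RHS]tuple_eta.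
Qed.

(** The start varies and the end is fixed, so that removing the first step of a walk leaves a walk
    of the same kind. *)
Definition walks_to_origin (n : nat) (p : int * int) : {set n.-tuple step} :=
  [set w | [forall k : 'I_n.+1, in_quadrant (p + position w k)]
           && (p + position w n == 0)].

Lemma position0 n (w : n.-tuple step) : position w 0 = 0.
Proof. by rewrite /position take0 big_nil. Qed.

Lemma position_cons n (s : step) (w : n.-tuple step) k :
  position [tuple of s :: w] k.+1 = ssval s + position w k.
Proof. by rewrite /position /= big_cons. Qed.

Lemma walks_to_origin_cons n (p : int * int) s (w : n.-tuple step) :
  ([tuple of s :: w] \in walks_to_origin n.+1 p) =
  in_quadrant p && (w \in walks_to_origin n (p + ssval s)).
Proof.
rewrite !inE position_cons !addrA andbA; congr andb.
apply/forallP/andP => [h|[p0 /forallP h] k].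
  split; first by have := h ord0; rewrite position0 addr0.
  by apply/forallP => k; have := h (lift ord0 k); rewrite position_cons addrA.
have [->|[k' ->]] : k = ord0 \/ exists k', k = lift ord0 k'.
- by case: (unliftP ord0 k) => [k' ->|->]; [right; exists k'|left].
- by rewrite position0 addr0.
- by rewrite position_cons addrA.
Qed.

Lemma card_walks_to_origin0 (p : int * int) :
  #|walks_to_origin 0 p| = (p == 0) :> nat.
Proof.
rewrite /walks_to_origin; have [->|p_neq0] := eqVneq p 0.
  rewrite -[RHS](card_tuple 0 step) -cardsT; congr #|pred_of_set _|.
  apply/setP => w; rewrite !inE position0 addr0 eqxx andbT.
  by apply/forallP => k; rewrite ord1 position0.
apply/eqP; rewrite cards_eq0; apply/eqP/setP => w.
by rewrite !inE position0 addr0 (negPf p_neq0) andbF.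
Qed.

Lemma card_walks_to_originS n (p : int * int) : in_quadrant p ->
  #|walks_to_origin n.+1 p| =
  (\sum_(s <- steps) #|walks_to_origin n (p + s)%R|)%N.
Proof.
move=> p_in.
(* [steps] has no repetition, so a sum over this list is a sum over the type [step]. *)
have -> : steps = [seq ssval s | s <- enum step].
  by rewrite enumT unlock /= val_seq_sub_enum.
rewrite big_map big_enum card_tuple_cons /=.
apply: eq_bigr => s _; apply: eq_card => w.
by rewrite inE walks_to_origin_cons p_in.
Qed.

Lemma card_walks_to_origin_out n (p : int * int) : ~~ in_quadrant p ->
  #|walks_to_origin n p| = 0%N.
Proof.
move=> /negPf p_out; apply/eqP; rewrite cards_eq0; apply/eqP/setP => w.
rewrite !inE; apply/negbTE; rewrite negb_and; apply/orP; left.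
by apply/forallPn; exists ord0; rewrite position0 addr0 p_out.
Qed.

Lemma q00E n : q 0 0 n = #|walks_to_origin n 0|.
Proof.
apply: eq_card => w; rewrite !inE add0r; congr (_ && _).
by apply: eq_forallb => k; rewrite add0r.
Qed.

(** * Unrestricted walks on the line and in the plane *)

(** Counts the walks with steps -1 and +1 from [m] to 0; integer values allow signed sums later. *)
Fixpoint line_walks (n : nat) (m : int) : int :=
  if n is n'.+1 then line_walks n' (m - 1) + line_walks n' (m + 1)
  else if m == 0 then 1 else 0.

Lemma line_walksN n m : line_walks n (- m) = line_walks n m.
Proof.
elim: n m => [|n IHn] m /=; first by rewrite oppr_eq0.
have -> : - m - 1 = - (m + 1) by ring.
have -> : - m + 1 = - (m - 1) by ring.
by rewrite !IHn [RHS]addrC.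
Qed.

Lemma line_walks_lt n (m : int) : m < - n%:Z -> line_walks n m = 0.
Proof.
elim: n m => [|n IHn] m lt_m /=; first by case: ifP => //; lia.
by rewrite !IHn ?addr0 //; lia.
Qed.

(** From 2k - n the walk reaches 0 exactly when k of its n steps are -1; the recursion is Pascal's
    rule. *)
Lemma line_walks_bin n (k : nat) :
  line_walks n ((2 * k)%:Z - n%:Z) = 'C(n, k)%:Z.
Proof.
elim: n k => [|n IHn] k /=.
  by rewrite bin0n; case: k.
have -> : (2 * k)%:Z - n.+1%:Z + 1 = (2 * k)%:Z - n%:Z by lia.
rewrite IHn; case: k => [|k].
  by rewrite line_walks_lt ?bin0 //; lia.
have -> : (2 * k.+1)%:Z - n.+1%:Z - 1 = (2 * k)%:Z - n%:Z by lia.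
by rewrite IHn binS; lia.
Qed.

Definition plane_walks (n : nat) (x y : int) : int :=
  line_walks n (x + y) * line_walks n (x - y).

Lemma plane_walksS n x y : plane_walks n.+1 x y =
  plane_walks n (x + 1) y + plane_walks n (x - 1) y +
  plane_walks n x (y + 1) + plane_walks n x (y - 1).
Proof.
rewrite /plane_walks /=.
have -> : x + 1 + y = x + y + 1 by ring.
have -> : x - 1 + y = x + y - 1 by ring.
have -> : x + (y + 1) = x + y + 1 by ring.
have -> : x + (y - 1) = x + y - 1 by ring.
have -> : x + 1 - y = x - y + 1 by ring.
have -> : x - 1 - y = x - y - 1 by ring.
have -> : x - (y + 1) = x - y - 1 by ring.
have -> : x - (y - 1) = x - y + 1 by ring.
by ring.
Qed.

(** Negating x exchanges x + y and x - y up to sign, and [line_walks] is even. *)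
Lemma plane_walksNl n x y : plane_walks n (- x) y = plane_walks n x y.
Proof.
rewrite /plane_walks -(line_walksN n (- x + y)) -(line_walksN n (- x - y)).
by rewrite !opprD !opprK mulrC.
Qed.

Lemma plane_walksNr n x y : plane_walks n x (- y) = plane_walks n x y.
Proof. by rewrite /plane_walks opprK mulrC. Qed.

(** * The reflection principle *)

(* The signed sum over the images of the endpoint under the reflections in
   the lines x = -1 and y = -1. *)
Definition reflected_walks (n : nat) (x y : int) : int :=
  plane_walks n x y - plane_walks n (x + 2) y - plane_walks n x (y + 2)
  + plane_walks n (x + 2) (y + 2).

Lemma reflected_walksS n x y : reflected_walks n.+1 x y =
  reflected_walks n (x + 1) y + reflected_walks n (x - 1) y +
  reflected_walks n x (y + 1) + reflected_walks n x (y - 1).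
Proof.
(* Moving the shift by 2 inside the unit shifts gives [ring] the same atoms on both sides. *)
rewrite /reflected_walks !plane_walksS !(addrAC _ _ 2).
by ring.
Qed.

(** At x = -1 the images have abscissas -1 and 1, so the terms cancel in pairs by symmetry. *)
Lemma reflected_walks_leftwall n y : reflected_walks n (- 1) y = 0.
Proof.
rewrite /reflected_walks (_ : -1 + 2 = 1) // !plane_walksNl.
by ring.
Qed.

Lemma reflected_walks_bottomwall n x : reflected_walks n x (- 1) = 0.
Proof.
rewrite /reflected_walks (_ : -1 + 2 = 1) // !plane_walksNr.
by ring.
Qed.

(** Both sides satisfy the same recurrence inside the quadrant, vanish on the walls and agree for n
    = 0. The walls are included so that the induction covers every neighbour of a quadrant point. *)
Lemma card_walks_to_originE n (x y : int) : -1 <= x -> -1 <= y ->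
  #|walks_to_origin n (x, y)|%:Z = reflected_walks n x y.
Proof.
elim: n x y => [|n IHn] x y x_ge y_ge.
all: have [->|x_neq] := eqVneq x (-1);
  first by rewrite card_walks_to_origin_out // reflected_walks_leftwall.
all: have [->|y_neq] := eqVneq y (-1);
  first by rewrite card_walks_to_origin_out ?reflected_walks_bottomwall //
    /in_quadrant /= andbF.
  rewrite card_walks_to_origin0 /reflected_walks /plane_walks /=.
  rewrite -[_ == _]/((x == 0) && (y == 0)).
  by do ![case: eqP => ? //=]; lia.
rewrite card_walks_to_originS; last by rewrite /in_quadrant /=; lia.
rewrite reflected_walksS /steps !big_cons big_nil addn0 !PoszD.
have pairD (a b : int) : (x, y) + (a, b) = (x + a, y + b) by [].
by rewrite !pairD !addr0 !IHn ?addrA //; lia.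
Qed.

Lemma q00_bin n : (q 0 0 (2 * n))%:Z =
  'C(2 * n, n)%:Z ^+ 2 - 2 * 'C(2 * n, n.+1)%:Z ^+ 2
  + 'C(2 * n, n)%:Z * 'C(2 * n, n.+2)%:Z.
Proof.
rewrite q00E card_walks_to_originE // /reflected_walks /plane_walks.
(* The three binomials are the values of [line_walks] at 0, 2 and 4. *)
rewrite -!line_walks_bin.
have -> : (2 * n)%:Z - (2 * n)%:Z = 0 by lia.
have -> : (2 * n.+1)%:Z - (2 * n)%:Z = 2 by lia.
have -> : (2 * n.+2)%:Z - (2 * n)%:Z = 4 by lia.
by rewrite !add0r !addr0 line_walksN subrr; ring.
Qed.

(** * Wallis integrals and the central binomial coefficient *)

Section Wallis.
Variable R : realType.
Implicit Types (n : nat) (x : R).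

(** The primitive of cos^n vanishing at 0, by the reduction formula from integration by parts. *)
Fixpoint cos_primitive n x : R :=
  match n with
  | 0 => x
  | 1 => sin x
  | n'.+2 =>
    (sin x * cos x ^+ n'.+1 + n'.+1%:R * cos_primitive n' x) / n'.+2%:R
  end.

Lemma is_derive_cos_primitive n x :
  is_derive x 1 (cos_primitive n) (cos x ^+ n).
Proof.
(* The recursion goes down by two, so the induction carries two consecutive cases. *)
suff : is_derive x 1 (cos_primitive n) (cos x ^+ n) /\
       is_derive x 1 (cos_primitive n.+1) (cos x ^+ n.+1) by case.
elim: n => [|n [IHn IHSn]].
  rewrite expr0 expr1; split; [exact: is_derive_id | exact: is_derive_sin].
split=> //=.
have -> : (fun x : R =>
      (sin x * cos x ^+ n.+1 + n.+1%:R * cos_primitive n x) / n.+2%:R) =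
    n.+2%:R^-1 \*: (sin * (cos ^+ n.+1) + n.+1%:R \*: (cos_primitive n)).
  by rewrite exprfctE; apply: funext => y; rewrite [LHS]mulrC.
apply: is_derive_eq.
have n2 : n.+2%:R != 0 :> R by rewrite pnatr_eq0.
have s2 : sin x ^+ 2 = 1 - cos x ^+ 2 by rewrite -(cos2Dsin2 x); ring.
rewrite exprfctE /= /GRing.scale /=.
apply: (mulfI n2); rewrite mulVKf //.
have -> : n.+2%:R = n.+1%:R + 1 :> R by rewrite [RHS]natr1.
rewrite !exprS; ring: s2.
Qed.

Lemma cos_primitive0 n : cos_primitive n 0 = 0.
Proof.
suff : cos_primitive n 0 = 0 /\ cos_primitive n.+1 0 = 0 by case.
elim: n => [|n [IHn IHSn]]; first by rewrite /= sin0.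
by split=> //=; rewrite IHn sin0 mul0r mulr0 addr0 mul0r.
Qed.

(* The integral of cos ^ n over [0, pi / 2], by the closed-form primitive. *)
Definition wallis n : R := cos_primitive n (pi / 2).

Lemma wallisSS n : wallis n.+2 = n.+1%:R / n.+2%:R * wallis n.
Proof. by rewrite /wallis /= cos_pihalf exprS mul0r mulr0 add0r mulrAC. Qed.

(** The difference of the primitives has derivative cos^n (1 - cos), nonnegative on [0, pi / 2]; the
    mean value theorem concludes. *)
Lemma wallis_nincr n : wallis n.+1 <= wallis n.
Proof.
pose f := cos_primitive n - cos_primitive n.+1.
have df x : is_derive x 1 f (cos x ^+ n - cos x ^+ n.+1).
  by apply: is_deriveB; exact: is_derive_cos_primitive.
have pi2_ge0 : 0 <= pi / 2 :> R by rewrite divr_ge0 // ltW // pi_gt0.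
have [|c] := MVT_segment pi2_ge0 (fun x _ => df x).
  by apply: derivable_within_continuous => x _; exact: ex_derive.
rewrite in_itv /= /f !fctE !cos_primitive0 !subr0 => /andP[c_ge0 c_le] fE.
rewrite -subr_ge0 /wallis fE exprS mulr_ge0 // -{1}[_ ^+ _]mul1r -mulrBl.
rewrite mulr_ge0 ?subr_ge0 ?cos_le1 // exprn_ge0 // cos_ge0_pihalf //.
by rewrite c_le andbT (le_trans _ c_ge0) // oppr_le0.
Qed.

(** By [wallisSS] the left side does not depend on n. *)
Lemma wallis_mulS n : n.+1%:R * (wallis n * wallis n.+1) = pi / 2.
Proof.
elim: n => [|n IHn]; first by rewrite /wallis /= sin_pihalf mulr1 mul1r.
rewrite -IHn wallisSS.
by field; rewrite -natrD pnatr_eq0.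
Qed.

Lemma wallis_double n : wallis (2 * n) = 'C(2 * n, n)%:R / 4 ^+ n * (pi / 2).
Proof.
elim: n => [|n IHn]; first by rewrite /wallis /= bin0 expr0 divr1 mul1r.
rewrite mulnS wallisSS IHn.
have binE : n.+1%:R * 'C(2 + 2 * n, n.+1)%:R =
    2 * (2 * n).+1%:R * 'C(2 * n, n)%:R :> R.
  rewrite -!natrM; congr _%:R.
  rewrite add2n -mul_bin_diag /=.
  have := mul_bin_down (2 * n).+1 n; rewrite /=.
  have -> : ((2 * n).+1 - n = n.+1)%N by lia.
  by nia.
have n1 : n.+1%:R != 0 :> R by rewrite pnatr_eq0.
have -> : 'C(2 + 2 * n, n.+1)%:R =
    2 * (2 * n).+1%:R * 'C(2 * n, n)%:R / n.+1%:R :> R.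
  by rewrite -binE mulrAC divff // mul1r.
have -> : (2 * n).+2%:R = 2 * n.+1%:R :> R by rewrite -natrM; congr _%:R; lia.
rewrite exprS.
field.
by rewrite expf_neq0 //= nat1r.
Qed.

(** Monotonicity puts W_(2n)^2 between W_(2n) W_(2n+1) and (2n+2)/(2n+1) times it, and [wallis_mulS]
    evaluates this product. *)
Lemma central_binomial_bounds n :
  (2 * n)%:R / (2 * n).+1%:R <=
    (pi : R) * n%:R * 'C(2 * n, n)%:R ^+ 2 / 16 ^+ n <= (1 : R).
Proof.
have pi0 : 0 < pi :> R := pi_gt0 R.
set u := (X in _ <= X <= _).
have uE : pi * u = 4 * n%:R * wallis (2 * n) ^+ 2.
  rewrite wallis_double /u.
  have -> : 16 ^+ n = 4 ^+ n ^+ 2 :> R by rewrite exprAC; congr (_ ^+ _); ring.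
  by field; rewrite expf_neq0.
have W0 : 0 < wallis (2 * n).
  rewrite wallis_double !mulr_gt0 ?divr_gt0 ?invr_gt0 ?exprn_gt0 ?ltr0n //.
  by rewrite bin_gt0; lia.
have WS := wallis_mulS (2 * n).
have lower := wallis_nincr (2 * n).
have upper := wallis_nincr (2 * n).+1.
rewrite wallisSS in upper.
have nE : (2 * n).+1%:R = 2 * n%:R + 1 :> R by rewrite -natr1 natrM.
have nE2 : (2 * n).+2%:R = 2 * n%:R + 2 :> R.
  by rewrite -natr1 nE; ring.
have n0 : 0 <= n%:R :> R by [].
rewrite natrM.
move: u uE => u; move: (n%:R : R) nE nE2 n0 WS upper => a -> -> a0 WS upper uE.
have d1 : 0 < 2 * a + 1 by lra.
have d2 : 0 < 2 * a + 2 by lra.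
rewrite mulrAC ler_pdivrMr // in upper.
move: (wallis (2 * n)) (wallis (2 * n).+1) W0 lower WS upper uE.
move=> W W' W0 lower WS upper uE.
have lowerW : W * W' <= W ^+ 2 by rewrite expr2 ler_pM2l.
have upperW : (2 * a + 1) * W ^+ 2 <= (2 * a + 2) * (W * W').
  by have := ler_wpM2l (ltW W0) upper; lra.
have {lowerW} lowerW : pi / 2 <= (2 * a + 1) * W ^+ 2 by rewrite -WS ler_pM2l.
have {upperW} upperW : (2 * a + 1) ^+ 2 * W ^+ 2 <= (a + 1) * pi.
  have -> : (a + 1) * pi = (2 * a + 2) * (pi / 2) :> R by field.
  by rewrite -WS expr2 -mulrA [leRHS]mulrCA ler_pM2l.
rewrite ler_pdivrMr //; apply/andP; split.
  rewrite -(ler_pM2l pi0) [leRHS]mulrA uE.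
  have := ler_wpM2l a0 lowerW; lra.
(* What remains is 4 a (a + 1) <= (2 a + 1)^2. *)
rewrite -(ler_pM2l pi0) uE mulr1 -(ler_pM2l (exprn_gt0 2 d1)).
have := ler_wpM2l a0 upperW.
nra.
Qed.

End Wallis.

(** * Closed form and asymptotics *)

Lemma q00_central_bin (R : realType) (n : nat) :
  (q 0 0 (2 * n))%:R =
  'C(2 * n, n)%:R ^+ 2 * (4 * n%:R + 2) / ((n%:R + 1) ^+ 2 * (n%:R + 2)) :> R.
Proof.
have n_ge0 : 0 <= n%:R :> R by [].
have n1 : n%:R + 1 != 0 :> R by lra.
have n2 : n%:R + 2 != 0 :> R by lra.
have c1E : 'C(2 * n, n.+1)%:R = 'C(2 * n, n)%:R * n%:R / (n%:R + 1) :> R.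
  apply: (mulfI n1); rewrite mulrCA mulfV // mulr1 mulrC.
  rewrite natr1 -!natrM mulnC mul_bin_left mulnC; congr (_ * _)%:R; lia.
have c2E : 'C(2 * n, n.+2)%:R =
    'C(2 * n, n.+1)%:R * (n%:R - 1) / (n%:R + 2) :> R.
  apply: (mulfI n2); rewrite mulrCA mulfV // mulr1.
  have -> : n%:R + 2 = n.+2%:R :> R by rewrite -natrD addn2.
  rewrite -natrM mul_bin_left.
  (* For n = 0 the natural subtraction truncates to 0 while n - 1 is -1 in [R]; the binomial factor
     vanishes there. *)
  case: n {n_ge0 n1 n2 c1E} => [|n]; first by rewrite !muln0 bin0n !mul0r.
  rewrite -natr1 addrK mulrC -natrM; congr (_ * _)%:R; lia.
have := congr1 (fun z : int => z%:~R : R) (q00_bin n).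
rewrite rmorphD rmorphB !rmorphM /= -!pmulrn => ->.
rewrite c2E c1E.
by field; rewrite n1 n2.
Qed.

Theorem proposition3p2 (R : realType) :
  asymp_equiv (fun n : nat => (q 0 0 (2 * n))%:R : R)
              (fun n : nat => 4 / pi * (16 ^+ n / n%:R ^+ 3)).
Proof.
rewrite /asymp_equiv.
have lower_cvg : (1 - 4 * harmonic n : R) @[n --> \oo] --> (1 : R).
  rewrite -[X in _ --> X]subr0 -[X in _ - X](mulr0 4).
  by apply: cvgB; [exact: cvg_cst | apply: cvgMr; exact: cvg_harmonic].
apply: (squeeze_cvgr _ lower_cvg (cvg_cst (1 : R))).
near=> n.
have n_gt0 : 0 < n%:R :> R by rewrite ltr0n; near: n; exact: nbhs_infty_gt.
have pi0 : pi != 0 :> R by rewrite gt_eqF // pi_gt0.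
pose u : R := pi * n%:R * 'C(2 * n, n)%:R ^+ 2 / 16 ^+ n.
have u_bounds : (2 * n)%:R / (2 * n).+1%:R <= u <= 1.
  exact: central_binomial_bounds.
rewrite /=.
(* The ratio is [u] times a rational function of n with limit 1. *)
have -> : (q 0 0 (2 * n))%:R / (4 / pi * (16 ^+ n / n%:R ^+ 3)) =
  u * ((2 * n%:R + 1) * n%:R ^+ 2 / (2 * ((n%:R + 1) ^+ 2 * (n%:R + 2)))) :> R.
  rewrite q00_central_bin /u; move: (pi : R) pi0 => p p0; field.
  by rewrite p0 expf_neq0 // !gt_eqF //; lra.
move: u_bounds; rewrite -(natr1 (2 * n)) -(natr1 n) natrM.
move: (n%:R : R) n_gt0 u => a a0 u /andP[lower upper].
have r_gt0 : 0 < (2 * a + 1) * a ^+ 2 / (2 * ((a + 1) ^+ 2 * (a + 2))).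
  by rewrite divr_gt0 ?mulr_gt0 ?exprn_gt0 //; lra.
apply/andP; split.
  apply: le_trans (ler_wpM2r (ltW r_gt0) lower).
  have -> : 2 * a / (2 * a + 1) *
      ((2 * a + 1) * a ^+ 2 / (2 * ((a + 1) ^+ 2 * (a + 2)))) =
      a ^+ 3 / ((a + 1) ^+ 2 * (a + 2)).
    by field; rewrite !gt_eqF //; lra.
  rewrite ler_pdivlMr ?mulr_gt0 ?exprn_gt0 //; try lra.
  (* The constant 4 cancels the square term: the right side is a^3 - 7 a - 6, at most a^3. *)
  have -> : (1 - 4 / (a + 1)) * ((a + 1) ^+ 2 * (a + 2)) =
      (a - 3) * (a + 1) * (a + 2).
    by field; rewrite !gt_eqF //; lra.
  nra.
apply: le_trans (ler_wpM2r (ltW r_gt0) upper) _.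
rewrite mul1r ler_pdivrMr ?mulr_gt0 ?exprn_gt0 //; try lra.
nra.
Unshelve. all: by end_near.
Qed.
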